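(* Let $d\ge1$ and let $X_1,X_2$ be independent isotropic random variables on $S^d$. Then $$V(X_1+X_2)=V(X_1)+V(X_2)-\frac{V(X_1)V(X_2)}{2}.$$
   Context: $S^d=\{x\in\mathbb{R}^{d+1}:\|x\|=1\}$, $P=(1,0,\dots,0)$. Random variables on $S^d$ are given by density functions with respect to the surface measure. Let $\theta_0$ denote the first polar angle of a point (for $d\ge2$, $\theta_0\in[0,\pi]$; for $d=1$, the point is $(\cos\theta_0,\sin\theta_0)$ with $\theta_0\in[-\pi,\pi)$), so $x_0=\cos\theta_0$. The variance is $V(X)=E[\|X-P\|^2]=E[2-2\cos\theta_0]$. A random variable is isotropic if, for $d\ge2$, its density depends only on $\theta_0$ (written $y\mapsto F(\langle y,P\rangle)$), and, for $d=1$, its density takes the same value at $\theta_0$ and $-\theta_0$. Sum of independent isotropic variables: for $d\ge2$, $X_1+X_2$ is the random variable obtained by first moving from $P$ to $x'$ distributed as $X_1$ and then from $x'$ isotropically around $x'$ as $X_2$ is around $P$, with density $f(x)=\int_{S^d}F_1(\langle x',P\rangle)F_2(\langle x,x'\rangle)\,dx'$; for $d=1$, it is the point whose angle is $\Theta_1+\Theta_2$ (mod $2\pi$), where $\Theta_i$ are the angles of $X_i$, i.e. with density $f(\theta_0)=\int_{-\pi}^{\pi}f_1(\theta_0')f_2(\theta_0-\theta_0')\,d\theta_0'$. *)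

(* Defs.v *)
From HB Require Import structures.
From mathcomp Require Import all_boot all_order all_algebra.
From mathcomp Require Import all_classical all_reals all_analysis.
Set Implicit Arguments. Unset Strict Implicit. Unset Printing Implicit Defensive.
Import Order.TTheory GRing.Theory Num.Theory.
Local Open Scope classical_set_scope.
Local Open Scope ring_scope.

Section SphereDefs.
Variable R : realType.

(* Points of R^n are n-tuples (with the product = Borel sigma-algebra). *)

(* Iterated Lebesgue integral over R^n (for nonnegative functions this is
   the Lebesgue integral on R^n, by Tonelli). *)
Fixpoint sph_iint (n : nat) : (n.-tuple R -> \bar R) -> \bar R :=
  match n return (n.-tuple R -> \bar R) -> \bar R with
  | 0 => fun h => h [tuple]
  | n'.+1 => fun h =>
      (\int[@lebesgue_measure R]_t sph_iint (fun x : n'.-tuple R => h [tuple of t :: x]))%E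
  end.

Definition sph_dot (n : nat) (x y : n.-tuple R) : R := \sum_(i < n) tnth x i * tnth y i.
Definition sph_nrm (n : nat) (x : n.-tuple R) : R := Num.sqrt (sph_dot x x).

Definition sphere (d : nat) (x : (d.+1).-tuple R) : Prop := sph_dot x x = 1.

(* first coordinate x_0 = <x, P>, with P = (1,0,...,0) *)
Definition sph_coord0 (d : nat) (x : (d.+1).-tuple R) : R := tnth x ord0.

Definition sph_normalize (n : nat) (x : n.-tuple R) : n.-tuple R :=
  map_tuple (fun a => a / sph_nrm x) x.

(* Integral over S^d with respect to the surface measure sigma, defined by
   the cone formula  sigma(A) = (d+1) * Leb{ t x | x in A, 0 < t <= 1 },
   i.e.  int_{S^d} g dsigma = (d+1) * int_{0<|x|<=1} g(x/|x|) dx. *)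
Definition sphere_int (d : nat) (g : (d.+1).-tuple R -> \bar R) : \bar R :=
  ((d.+1)%:R)%:E * sph_iint (fun x : (d.+1).-tuple R =>
    if ((0 < sph_nrm x) && (sph_nrm x <= 1))%R then g (sph_normalize x) else 0%E).

(* A random variable on S^d given by a density f w.r.t. surface measure. *)
Definition sph_is_density (d : nat) (f : (d.+1).-tuple R -> R) : Prop :=
  measurable_fun [set x | sphere x] f /\
  (forall x, sphere x -> 0 <= f x) /\
  sphere_int (fun x => (f x)%:E) = 1%E.

(* For d = 1: the point (cos t, sin t) of S^1 (the expression is written for
   general d, padding with zeros, but it is only used when d = 1). *)
Definition sph_pt (d : nat) (t : R) : (d.+1).-tuple R :=
  [tuple if i == 0%N :> nat then cos t else if i == 1%N :> nat then sin t else 0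
  | i < d.+1].

Definition sph_isotropic (d : nat) (f : (d.+1).-tuple R -> R) : Prop :=
  if d == 1%N then forall t : R, f (sph_pt d t) = f (sph_pt d (- t))
  else exists F : R -> R, forall y, sphere y -> f y = F (sph_coord0 y).

(* f is the density of X1 + X2 (X1, X2 independent, sph_isotropic with
   densities f1, f2).  For d >= 2:
     f(x) = int_{S^d} F1(<x',P>) F2(<x,x'>) dx'  where f_i(y) = F_i(<y,P>);
   for d = 1 (angles):
     f(theta_0) = int_{-pi}^{pi} f1(theta') f2(theta_0 - theta') dtheta',
   the angle theta_0 - theta' being taken mod 2pi (automatic via sph_pt). *)
Definition sph_is_sum_density (d : nat) (f1 f2 : (d.+1).-tuple R -> R)
    (f : (d.+1).-tuple R -> \bar R) : Prop :=
  if d == 1%N then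
    forall t0 : R, f (sph_pt d t0) =
      (\int[@lebesgue_measure R]_(t in `[(- pi)%R, pi[)
         (f1 (sph_pt d t) * f2 (sph_pt d (t0 - t)))%:E)%E
  else
    forall F1 F2 : R -> R,
      (forall y, sphere y -> f1 y = F1 (sph_coord0 y)) ->
      (forall y, sphere y -> f2 y = F2 (sph_coord0 y)) ->
      forall x, sphere x ->
        f x = sphere_int (fun x' => (F1 (sph_coord0 x') * F2 (sph_dot x x'))%:E).

(* V(X) = E ||X - P||^2 = E[2 - 2 cos theta_0] for a random variable with
   (extended-real valued) density f on S^d. *)
Definition sph_variance (d : nat) (f : (d.+1).-tuple R -> \bar R) : \bar R :=
  sphere_int (fun x => ((2 - 2 * sph_coord0 x)%:E * f x)%E).

End SphereDefs.

(* Main.v *)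
Require Import Defs.
From HB Require Import structures.
From mathcomp Require Import all_boot all_order all_algebra.
From mathcomp Require Import all_classical all_reals all_analysis.
From mathcomp Require Import measurable_realfun ring lra.
Import Order.TTheory GRing.Theory Num.Theory.
Import numFieldNormedType.Exports.
Local Open Scope classical_set_scope.
Local Open Scope ring_scope.

Set Implicit Arguments.
Unset Strict Implicit.
Unset Printing Implicit Defensive.

(** Write [f_i(y) = F_i(y_0)], [V_i = E(2 - 2 x_0)] and [W_i = E(2 + 2 x_0)], so that
    [V_i + W_i = 4]. By Tonelli, [V(X_1 + X_2)] is the integral over [x'] of [F_1(x'_0)] times
    [int (2 - 2 x_0) F_2(<x, x'>) dx]. Moving [x'] to [P] by an isometry turns the latter into
    [int (2 - 2 <y, x'>) F_2(y_0) dy], in which the components of [y] orthogonal to [P] cancel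
    by symmetry; what remains is [(1 + x'_0)/2 V_2 + (1 - x'_0)/2 W_2]. Hence
    [V(X_1 + X_2) = (W_1 V_2 + V_1 W_2)/4], which is the claim.

    Lebesgue measure on [R^n] is an iterated integral here, so its invariance under the isometry
    comes from writing a plane rotation as a product of three shears. For [d = 1] the sum is
    defined with the angular measure, which is identified with the surface measure by
    uniqueness of the rotation-invariant measure and the area of the unit disc. *)

(** * Invariance of Lebesgue measure on the line under translation and negation *)

Section lebesgue_translation.
Context {R : realType}.
Notation mu := (@lebesgue_measure R).

(** Lebesgue measure is determined by its values on the intervals []x, y]], and the preimage of such
    an interval under a translation is an interval of the same length. *)
Lemma lebesgue_measureD (a : R) (A : set R) : measurable A ->
  pushforward mu ((fun t => t + a) : R -> measurableTypeR R) A = mu A.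
Proof.
move=> mA; apply/esym/lebesgue_measure_unique => //=.
  by apply: measurable_funD.
move=> _ _ [[x y]] _ <-.
rewrite /pushforward.
have -> : (fun t : R => t + a) @^-1` `]x, y] = `]x - a, y - a]%classic.
  by apply/seteqP; split=> t /=; rewrite !in_itv/= ltrBlDr lerBrDr.
rewrite !lebesgue_measure_itv/= !lte_fin ltrD2r -!EFinB.
by case: ifP => // _; congr EFin; ring.
Qed.

Local Open Scope ereal_scope.

Lemma ge0_integralT_shift (a : R) (f : R -> \bar R) :
  measurable_fun setT f -> (forall t, 0 <= f t) ->
  \int[mu]_t f (t + a)%R = \int[mu]_t f t.
Proof.
move=> mf f0.
transitivity (\int[mu]_(t in ((fun t => (t + a)%R) : R -> measurableTypeR R) @^-1` setT)
   (f \o (fun t => (t + a)%R)) t); first by rewrite preimage_setT.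
rewrite -ge0_integral_pushforward//=.
  apply: eq_measure_integral => //=; first exact: measurable_funD.
  by move=> ? A mA _; exact: lebesgue_measureD.
by apply: measurable_funD.
Qed.

Lemma ge0_integralT_opp (f : R -> \bar R) :
  measurable_fun setT f -> (forall t, 0 <= f t) ->
  \int[mu]_t f (- t)%R = \int[mu]_t f t.
Proof.
move=> mf f0.
transitivity (\int[mu]_(t in (-%R : R -> measurableTypeR R) @^-1` setT)
   (f \o -%R) t); first by rewrite preimage_setT.
rewrite -ge0_integral_pushforward//=.
by apply: eq_measure_integral => //= A mA _; exact: lebesgue_measureN.
Qed.

End lebesgue_translation.

(** * Calculus of the iterated integral on [R^n]: Tonelli, linearity, translation, negation *)

Section iterated_integral.
Context {R : realType}.
Notation mu := (@lebesgue_measure R).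
Local Open Scope ereal_scope.

Lemma eq_sph_iint n (h k : n.-tuple R -> \bar R) :
  (forall x, h x = k x) -> sph_iint h = sph_iint k.
Proof. by move=> hk; congr sph_iint; apply/funext. Qed.

Lemma sph_iint_ge0 n (h : n.-tuple R -> \bar R) :
  (forall x, 0 <= h x) -> 0 <= sph_iint h.
Proof.
elim: n h => [|n IH] h h0 /=; first exact: h0.
by apply: integral_ge0 => t _; exact: IH.
Qed.

Lemma sph_iint0 n : sph_iint (fun=> 0 : \bar R) (n := n) = 0.
Proof. by elim: n => //= n IH; under eq_integral do rewrite IH; rewrite integral0. Qed.

(** The parameter space [T] is arbitrary so that the induction on [n] can absorb the outermost
    coordinate into it, replacing [T] by [T * R]. *)
Lemma measurable_sph_iint n d (T : measurableType d) (h : T * n.-tuple R -> \bar R) :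
  measurable_fun setT h -> (forall z, 0 <= h z) ->
  measurable_fun setT (fun s => sph_iint (fun x => h (s, x))).
Proof.
elim: n d T h => [|n IH] d T h mh h0 /=.
  by apply: (measurableT_comp mh) => /=; exact: measurable_fun_pair.
pose k (z : T * R) := sph_iint (fun x : n.-tuple R => h (z.1, [tuple of z.2 :: x])).
apply: (measurable_fun_fubini_tonelli_F (m2 := mu) k).
  apply: (IH _ _ (fun p : (T * R) * n.-tuple R => h (p.1.1, [tuple of p.1.2 :: p.2]))) => //.
  apply: (measurableT_comp mh) => /=.
  apply: measurable_fun_pair; first exact: measurableT_comp.
  by apply: measurable_cons => //; exact: measurableT_comp.
by move=> z; exact: sph_iint_ge0.
Qed.

(** One application of Tonelli per coordinate: the integral over [s] is exchanged with that over the
    first coordinate, then the induction hypothesis applies with this coordinate frozen. *)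
Lemma integral_sph_iint n d (T : measurableType d)
    (m : {sigma_finite_measure set T -> \bar R}) (h : T * n.-tuple R -> \bar R) :
  measurable_fun setT h -> (forall z, 0 <= h z) ->
  \int[m]_s sph_iint (fun x => h (s, x)) = sph_iint (fun x => \int[m]_s h (s, x)).
Proof.
elim: n h => [|n IH] h mh h0 //=.
pose k (z : T * R) := sph_iint (fun x : n.-tuple R => h (z.1, [tuple of z.2 :: x])).
rewrite (fubini_tonelli (m1 := m) (m2 := mu) k); last 2 first.
- apply: (measurable_sph_iint (h := fun p : (T * R) * n.-tuple R => h (p.1.1, [tuple of p.1.2 :: p.2]))) => //.
  apply: (measurableT_comp mh) => /=.
  apply: measurable_fun_pair; first exact: measurableT_comp.
  by apply: measurable_cons => //; exact: measurableT_comp.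
- by move=> z; exact: sph_iint_ge0.
apply: eq_integral => t _ /=.
rewrite -(IH (fun z => h (z.1, [tuple of t :: z.2])))//.
apply: (measurableT_comp mh) => /=.
by apply: measurable_fun_pair => //; exact: measurable_cons.
Qed.

(** The coordinates of the first point are moved inside one by one, each by the exchange of a single
    integral with an iterated one. *)
Lemma sph_iint_iint m n (h : m.-tuple R * n.-tuple R -> \bar R) :
  measurable_fun setT h -> (forall z, 0 <= h z) ->
  sph_iint (fun x => sph_iint (fun y => h (x, y))) =
  sph_iint (fun y => sph_iint (fun x => h (x, y))).
Proof.
elim: m h => [|m IH] h mh h0 //=.
rewrite -(integral_sph_iint mu
   (h := fun z => sph_iint (fun x => h ([tuple of z.1 :: x], z.2)))); last 2 first.
- apply: (measurable_sph_iint (h := fun p : (R * n.-tuple R) * m.-tuple R =>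
     h ([tuple of p.1.1 :: p.2], p.1.2))) => //.
  apply: (measurableT_comp mh) => /=.
  apply: measurable_fun_pair; last exact: measurableT_comp.
  by apply: measurable_cons => //; exact: measurableT_comp.
- by move=> z; exact: sph_iint_ge0.
apply: eq_integral => t _ /=.
rewrite (IH (fun z => h ([tuple of t :: z.1], z.2)))//.
apply: (measurableT_comp mh) => /=.
apply: measurable_fun_pair => //.
by apply: measurable_cons => //; exact: measurableT_comp.
Qed.

Lemma sph_iintD n (h k : n.-tuple R -> \bar R) :
  measurable_fun setT h -> (forall z, 0 <= h z) ->
  measurable_fun setT k -> (forall z, 0 <= k z) ->
  sph_iint (fun x => h x + k x) = sph_iint h + sph_iint k.
Proof.
elim: n h k => [|n IH] h k mh h0 mk k0 //=.
rewrite -ge0_integralD//.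
- apply: eq_integral => t _ /=.
  rewrite IH//.
    by apply: (measurableT_comp mh) => /=; exact: measurable_cons.
  by apply: (measurableT_comp mk) => /=; exact: measurable_cons.
- by move=> *; exact: sph_iint_ge0.
- apply: (measurable_sph_iint (h := fun z => h [tuple of z.1 :: z.2])) => //.
  by apply: (measurableT_comp mh) => /=; exact: measurable_cons.
- by move=> *; exact: sph_iint_ge0.
- apply: (measurable_sph_iint (h := fun z => k [tuple of z.1 :: z.2])) => //.
  by apply: (measurableT_comp mk) => /=; exact: measurable_cons.
Qed.

Lemma sph_iintZ n c (h : n.-tuple R -> \bar R) : 0 <= c ->
  measurable_fun setT h -> (forall z, 0 <= h z) ->
  sph_iint (fun x => c * h x) = c * sph_iint h.
Proof.
move=> c0; elim: n h => [|n IH] h mh h0 //=.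
rewrite -ge0_integralZl//.
- apply: eq_integral => t _ /=.
  by rewrite IH//; apply: (measurableT_comp mh) => /=; exact: measurable_cons.
- apply: (measurable_sph_iint (h := fun z => h [tuple of z.1 :: z.2])) => //.
  by apply: (measurableT_comp mh) => /=; exact: measurable_cons.
- by move=> *; exact: sph_iint_ge0.
Qed.

Definition tuple_axpy n (k : R) (v x : n.-tuple R) : n.-tuple R :=
  [tuple (tnth x i + k * tnth v i)%R | i < n].

Definition tuple_opp n (x : n.-tuple R) : n.-tuple R := map_tuple -%R x.

Lemma tnth_behead_tuple n (x : n.+1.-tuple R) i :
  tnth [tuple of behead x] i = tnth x (lift ord0 i).
Proof. by rewrite [in RHS](tuple_eta x) tnthS. Qed.

Lemma tuple_axpy_cons n k (v : n.+1.-tuple R) t (x : n.-tuple R) :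
  tuple_axpy k v [tuple of t :: x] =
  [tuple of (t + k * thead v)%R :: tuple_axpy k [tuple of behead v] x].
Proof.
apply: eq_from_tnth => i; case: (unliftP ord0 i) => [j|] ->.
  by rewrite tnth_mktuple !tnthS tnth_mktuple tnth_behead_tuple.
by rewrite tnth_mktuple !tnth0.
Qed.

Lemma tuple_opp_cons n t (x : n.-tuple R) :
  tuple_opp [tuple of t :: x] = [tuple of (- t)%R :: tuple_opp x].
Proof. exact: val_inj. Qed.

Lemma measurable_tuple_axpy n d (T : measurableType d) (k : T -> R) (v : n.-tuple R)
   (x : T -> n.-tuple R) : measurable_fun setT k -> measurable_fun setT x ->
  measurable_fun setT (fun s => tuple_axpy (k s) v (x s)).
Proof.
move=> mk mx; apply/measurable_fun_tnthP => i /=.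
apply: (eq_measurable_fun (fun s => (tnth (x s) i + k s * tnth v i)%R)).
  by move=> s _; rewrite /= tnth_mktuple.
apply: measurable_funD; last exact: measurable_funM.
by apply: (measurableT_comp (f := fun x => tnth x i)) => //; exact: measurable_tnth.
Qed.

Lemma measurable_tuple_opp n : measurable_fun setT (@tuple_opp n).
Proof.
apply/measurable_fun_tnthP => i /=.
apply: (eq_measurable_fun (fun s : n.-tuple R => (- tnth s i)%R)).
  by move=> s _; rewrite /= tnth_map.
by apply: measurableT_comp => //; exact: measurable_tnth.
Qed.

Lemma sph_iint_shift n k v (h : n.-tuple R -> \bar R) :
  measurable_fun setT h -> (forall z, 0 <= h z) ->
  sph_iint (fun x => h (tuple_axpy k v x)) = sph_iint h.
Proof.
elim: n v h => [|n IH] v h mh h0 /=; first by rewrite [tuple_axpy _ _ _]tuple0.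
under eq_integral => t _.
  under eq_sph_iint do rewrite tuple_axpy_cons.
  rewrite (IH _ (fun x => h [tuple of (t + k * thead v)%R :: x]))//; last first.
    by apply: (measurableT_comp mh) => /=; exact: measurable_cons.
  over.
rewrite (ge0_integralT_shift _ (f := fun t => sph_iint (fun x => h [tuple of t :: x])))//.
  apply: (measurable_sph_iint (h := fun z => h [tuple of z.1 :: z.2])) => //.
  by apply: (measurableT_comp mh) => /=; exact: measurable_cons.
by move=> *; exact: sph_iint_ge0.
Qed.

Lemma sph_iint_opp n (h : n.-tuple R -> \bar R) :
  measurable_fun setT h -> (forall z, 0 <= h z) ->
  sph_iint (fun x => h (tuple_opp x)) = sph_iint h.
Proof.
elim: n h => [|n IH] h mh h0 /=; first by rewrite [tuple_opp _]tuple0.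
under eq_integral => t _.
  under eq_sph_iint do rewrite tuple_opp_cons.
  rewrite (IH (fun x => h [tuple of (- t)%R :: x]))//; last first.
    by apply: (measurableT_comp mh) => /=; exact: measurable_cons.
  over.
rewrite (ge0_integralT_opp (f := fun t => sph_iint (fun x => h [tuple of t :: x])))//.
  apply: (measurable_sph_iint (h := fun z => h [tuple of z.1 :: z.2])) => //.
  by apply: (measurableT_comp mh) => /=; exact: measurable_cons.
by move=> *; exact: sph_iint_ge0.
Qed.

End iterated_integral.

(** * Algebra and measurability of the dot product, the norm and the normalization *)

Section dot_product.
Context {R : realType}.
Implicit Types n : nat.

(** The scalar stands on the right so that [sph_normalize x] is [tuple_scale (sph_nrm x)^-1 x] by
    conversion. *)
Definition tuple_scale n (k : R) (x : n.-tuple R) : n.-tuple R :=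
  map_tuple (fun a => a * k) x.

Lemma sph_dot_ge0 n (x : n.-tuple R) : 0 <= sph_dot x x.
Proof. by apply: sumr_ge0 => i _; rewrite -expr2 sqr_ge0. Qed.

Lemma sph_dotC n (x y : n.-tuple R) : sph_dot x y = sph_dot y x.
Proof. by apply: eq_bigr => i _; rewrite mulrC. Qed.

Lemma sph_dot_thead n (x y : n.+1.-tuple R) :
  sph_dot x y = thead x * thead y + sph_dot [tuple of behead x] [tuple of behead y].
Proof.
rewrite /sph_dot big_ord_recl; congr (_ + _).
by apply: eq_bigr => i _; rewrite !tnth_behead_tuple.
Qed.

Lemma sph_dot_axpy n k (v x w : n.-tuple R) :
  sph_dot w (tuple_axpy k v x) = sph_dot w x + k * sph_dot w v.
Proof.
rewrite /sph_dot mulr_sumr -big_split; apply: eq_bigr => i _ /=.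
by rewrite tnth_mktuple; ring.
Qed.

Lemma sph_dot_opp n (x w : n.-tuple R) : sph_dot w (tuple_opp x) = - sph_dot w x.
Proof. by rewrite /sph_dot -sumrN; apply: eq_bigr => i _; rewrite tnth_map mulrN. Qed.

Lemma sph_dot_scale n k (x w : n.-tuple R) : sph_dot w (tuple_scale k x) = sph_dot w x * k.
Proof. by rewrite /sph_dot mulr_suml; apply: eq_bigr => i _; rewrite tnth_map mulrA. Qed.

(** A vanishing sum of squares has only zero terms. This serves the pole [-P], whose tail has norm
    zero. *)
Lemma sph_dot_eq0 n (x w : n.-tuple R) : sph_dot x x = 0 -> sph_dot x w = 0.
Proof.
move=> x0; apply: big1 => i _.
have /psumr_eq0P h := x0.
have /eqP : tnth x i * tnth x i = 0.
  by apply: h => // j _; rewrite -expr2 sqr_ge0.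
by rewrite mulf_eq0 orbb => /eqP->; rewrite mul0r.
Qed.

Lemma measurable_sph_dot n d (T : measurableType d) (x y : T -> n.-tuple R) :
  measurable_fun setT x -> measurable_fun setT y ->
  measurable_fun setT (fun s => sph_dot (x s) (y s)).
Proof.
move=> mx my; apply: measurable_sum => i.
by apply: measurable_funM;
  apply: (measurableT_comp (f := fun x => tnth x i)) => //; exact: measurable_tnth.
Qed.

Lemma measurable_sph_nrm n : measurable_fun setT (@sph_nrm R n).
Proof.
apply: (measurableT_comp (f := Num.sqrt : R -> R) (g := fun x : n.-tuple R => sph_dot x x));
  last exact: measurable_sph_dot.
by apply: continuous_measurable_fun; exact: sqrt_continuous.
Qed.

Lemma measurable_sph_normalize n : measurable_fun setT (@sph_normalize R n).
Proof.
apply/measurable_fun_tnthP => i.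
(* The inverse of the norm is rewritten as a real power, whose measurability is available; the two
   agree on nonnegative numbers, zero included. *)
apply: (eq_measurable_fun (fun x : n.-tuple R => tnth x i * (sph_nrm x) `^ (-1))).
  by move=> x _ /=; rewrite tnth_map powR_inv1 ?sqrtr_ge0.
apply: measurable_funM; first exact: measurable_tnth.
apply: (measurableT_comp (f := fun a : R => a `^ (-1))); last exact: measurable_sph_nrm.
exact: measurable_powR.
Qed.

Lemma sph_nrm_sqr n (x : n.-tuple R) : sph_nrm x ^+ 2 = sph_dot x x.
Proof. by rewrite /sph_nrm sqr_sqrtr ?sph_dot_ge0. Qed.

Lemma sphere_normalize d (x : d.+1.-tuple R) : 0 < sph_nrm x -> sphere (sph_normalize x).
Proof.
move=> x0; rewrite /sphere -[sph_normalize x]/(tuple_scale (sph_nrm x)^-1 x).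
rewrite sph_dot_scale sph_dotC sph_dot_scale -mulrA -sph_nrm_sqr.
by rewrite -invfM -expr2 divff// expf_neq0// gt_eqF.
Qed.

Lemma sphere_coord0_itv d (x : d.+1.-tuple R) : sphere x -> -1 <= sph_coord0 x <= 1.
Proof.
rewrite /sphere sph_dot_thead => h.
have := sph_dot_ge0 [tuple of behead x]; rewrite /sph_coord0 -/(thead x) => ?.
nra.
Qed.

Lemma measurable_sph_coord0 d : measurable_fun setT (@sph_coord0 R d).
Proof. exact: measurable_tnth. Qed.

End dot_product.

(** * Linearity and parameter integrals for the surface integral *)

Section sphere_integral.
Context {R : realType}.
Local Open Scope ereal_scope.
Variable d : nat.
Notation pt := (d.+1.-tuple R).

(** The integrand of the cone formula: [g] extended along rays to the punctured unit ball, and by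
    zero elsewhere. *)
Definition sph_cone (g : pt -> \bar R) (x : pt) : \bar R :=
  if ((0 < sph_nrm x) && (sph_nrm x <= 1))%R then g (sph_normalize x) else 0.

Lemma sphere_intE g : sphere_int g = (d.+1%:R)%:E * sph_iint (sph_cone g).
Proof. by []. Qed.

Lemma eq_sphere_int (g k : pt -> \bar R) :
  (forall x, sphere x -> g x = k x) -> sphere_int g = sphere_int k.
Proof.
move=> gk; congr (_ * _); apply: eq_sph_iint => x.
by case: ifPn => // /andP[x0 _]; apply: gk; exact: sphere_normalize.
Qed.

Lemma sphere_int0 : sphere_int (fun=> 0 : \bar R) (d := d) = 0.
Proof.
rewrite sphere_intE (_ : sph_iint _ = 0) ?mule0// -[RHS](@sph_iint0 R d.+1).
by apply: eq_sph_iint => x; rewrite /sph_cone; case: ifP.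
Qed.

Lemma sph_cone_ge0 (g : pt -> \bar R) x :
  (forall x, sphere x -> 0 <= g x) -> 0 <= sph_cone g x.
Proof.
move=> g0; rewrite /sph_cone; case: ifPn => // /andP[x0 _].
by apply: g0; exact: sphere_normalize.
Qed.

Lemma measurable_sph_cone_param d' (T : measurableType d') (h : T * pt -> \bar R) :
  measurable_fun setT h ->
  measurable_fun setT (fun z : T * pt => sph_cone (fun x => h (z.1, x)) z.2).
Proof.
move=> mh; apply: measurable_fun_ifT => //.
  have mn : measurable_fun setT (fun z : T * pt => sph_nrm z.2).
    by apply: measurableT_comp => //; exact: measurable_sph_nrm.
  apply: measurable_and; first exact: measurable_fun_ltr.
  exact: measurable_fun_ler.
apply: (measurableT_comp mh) => /=.
apply: measurable_fun_pair => //.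
by apply: measurableT_comp => //; exact: measurable_sph_normalize.
Qed.

Lemma measurable_sph_cone (g : pt -> \bar R) :
  measurable_fun setT g -> measurable_fun setT (sph_cone g).
Proof.
move=> mg.
apply: (measurableT_comp (measurable_sph_cone_param (T := unit) (h := g \o snd) _)
   (g := fun x => (tt, x))).
  exact: measurableT_comp.
exact: measurable_fun_pair.
Qed.

Lemma sphere_int_ge0 (g : pt -> \bar R) :
  (forall x, sphere x -> 0 <= g x) -> 0 <= sphere_int g.
Proof.
move=> g0; rewrite sphere_intE mule_ge0 ?lee_fin ?ler0n//.
by apply: sph_iint_ge0 => x; exact: sph_cone_ge0.
Qed.

Lemma sphere_intD (g k : pt -> \bar R) :
  measurable_fun setT g -> (forall x, sphere x -> 0 <= g x) ->
  measurable_fun setT k -> (forall x, sphere x -> 0 <= k x) ->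
  sphere_int (fun x => g x + k x) = sphere_int g + sphere_int k.
Proof.
move=> mg g0 mk k0; rewrite !sphere_intE -ge0_muleDr; last 2 first.
- by apply: sph_iint_ge0 => x; exact: sph_cone_ge0.
- by apply: sph_iint_ge0 => x; exact: sph_cone_ge0.
rewrite -sph_iintD.
- congr (_ * _); apply: eq_sph_iint => x; rewrite /sph_cone.
  by case: ifP => // _; rewrite adde0.
- exact: measurable_sph_cone.
- by move=> x; exact: sph_cone_ge0.
- exact: measurable_sph_cone.
- by move=> x; exact: sph_cone_ge0.
Qed.

Lemma sphere_intZ c (g : pt -> \bar R) : 0 <= c ->
  measurable_fun setT g -> (forall x, sphere x -> 0 <= g x) ->
  sphere_int (fun x => c * g x) = c * sphere_int g.
Proof.
move=> c0 mg g0; rewrite !sphere_intE muleCA -[c * sph_iint _]sph_iintZ//.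
- congr (_ * _); apply: eq_sph_iint => x; rewrite /sph_cone.
  by case: ifP => // _; rewrite mule0.
- exact: measurable_sph_cone.
- by move=> x; exact: sph_cone_ge0.
Qed.

(** The condition selecting the punctured ball does not involve [s], so the exchange reduces to the
    one for the iterated integral applied to the cone of [h]. *)
Lemma integral_sphere_int d' (T : measurableType d')
    (m : {sigma_finite_measure set T -> \bar R}) (h : T * pt -> \bar R) :
  measurable_fun setT h -> (forall s x, sphere x -> 0 <= h (s, x)) ->
  \int[m]_s sphere_int (fun x => h (s, x)) = sphere_int (fun x => \int[m]_s h (s, x)).
Proof.
move=> mh h0; rewrite sphere_intE.
have mc := measurable_sph_cone_param mh.
have c0 (z : T * pt) : 0 <= sph_cone (fun x => h (z.1, x)) z.2.
  by apply: sph_cone_ge0 => x; exact: h0.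
transitivity ((d.+1%:R)%:E * sph_iint (fun x => \int[m]_s sph_cone (fun x => h (s, x)) x)).
  rewrite -(integral_sph_iint m (h := fun z => sph_cone (fun x => h (z.1, x)) z.2))//.
  rewrite -ge0_integralZl ?lee_fin ?ler0n//.
    exact: (measurable_sph_iint (h := fun z => sph_cone (fun x => h (z.1, x)) z.2)).
  by move=> s _; apply: sph_iint_ge0 => x; exact: (c0 (s, x)).
congr (_ * _); apply: eq_sph_iint => x; rewrite /sph_cone.
by case: ifP => // _; rewrite integral0.
Qed.

End sphere_integral.

(** * Tonelli for two surface integrals *)

Section sphere_tonelli.
Context {R : realType}.
Local Open Scope ereal_scope.

Lemma sphere_int_sphere_int (d e : nat)
    (h : d.+1.-tuple R * e.+1.-tuple R -> \bar R) :
  measurable_fun setT h -> (forall x y, sphere x -> sphere y -> 0 <= h (x, y)) ->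
  sphere_int (fun x => sphere_int (fun y => h (x, y))) =
  sphere_int (fun y => sphere_int (fun x => h (x, y))).
Proof.
move=> mh h0.
(* [K] is the cone of [h] in both variables; unlike [h], it is nonnegative everywhere, as Tonelli on
   the ambient spaces requires. *)
pose K z := sph_cone (fun x => sph_cone (fun y => h (x, y)) z.2) z.1.
have mK : measurable_fun setT K.
  pose k (z : (d.+1.-tuple R * e.+1.-tuple R)) := sph_cone (fun y => h (z.1, y)) z.2.
  have mk : measurable_fun setT k by exact: measurable_sph_cone_param.
  have := measurable_sph_cone_param (h := fun z : e.+1.-tuple R * d.+1.-tuple R => k (z.2, z.1)).
  have mk' : measurable_fun setT (fun z : e.+1.-tuple R * d.+1.-tuple R => k (z.2, z.1)).
    by apply: (measurableT_comp mk); exact: measurable_fun_pair.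
  move=> /(_ mk') mK.
  by apply: (measurableT_comp mK (g := fun z => (z.2, z.1))); exact: measurable_fun_pair.
have K0 z : 0 <= K z.
  by apply: sph_cone_ge0 => x sx; apply: sph_cone_ge0 => y sy; exact: h0.
(* Stated for arbitrary dimensions and kernel, so that it unfolds the double integral in either
   order. *)
have L0 (a b : nat) (k : a.+1.-tuple R -> b.+1.-tuple R -> \bar R) :
    measurable_fun setT (fun z => sph_cone (fun x => sph_cone (k x) z.2) z.1) ->
    (forall x y, sphere x -> sphere y -> 0 <= k x y) ->
    sphere_int (fun x => sphere_int (k x)) = a.+1%:R%:E * (b.+1%:R%:E *
      sph_iint (fun x => sph_iint (fun y => sph_cone (fun x => sph_cone (k x) y) x))).
  move=> mk k0; rewrite sphere_intE; congr (_ * _).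
  rewrite -sph_iintZ; last 3 first.
  - by rewrite lee_fin ler0n.
  - apply: (measurable_sph_iint (h := fun z => sph_cone (fun x => sph_cone (k x) z.2) z.1)) => //.
    by move=> z; apply: sph_cone_ge0 => x sx; apply: sph_cone_ge0 => y sy; exact: k0.
  - move=> x; apply: sph_iint_ge0 => y.
    by apply: sph_cone_ge0 => ? ?; apply: sph_cone_ge0 => ? ?; exact: k0.
  apply: eq_sph_iint => x; rewrite /sph_cone; case: ifP => _ //.
  by rewrite sph_iint0 mule0.
rewrite L0//.
rewrite (L0 _ _ (fun y x => h (x, y))).
- rewrite muleCA; congr (_ * (_ * _)).
  rewrite (sph_iint_iint mK K0).
  apply: eq_sph_iint => y; apply: eq_sph_iint => x; rewrite /K /sph_cone.
  by case: ifP => //; case: ifP.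
- rewrite (_ : (fun _ => _) = (fun z => K (z.2, z.1))).
    by apply: (measurableT_comp mK (g := fun z => (z.2, z.1))); exact: measurable_fun_pair.
  by apply/funext => z; rewrite /K /sph_cone; case: ifP => //; case: ifP.
- by move=> *; exact: h0.
Qed.

End sphere_tonelli.

(** * Shears, the isometry moving [P] to a given point, and invariance of the iterated integral *)

Section rotation.
Context {R : realType}.
Variable n : nat.
Notation pt := (n.+1.-tuple R).

(** This shear and the next change one of the two blocks (coordinate 0, the tail) by a linear
    function of the other; with the other block frozen, each is a translation. *)
Definition shear_head (a : R) (v : n.-tuple R) (y : pt) : pt :=
  [tuple of thead y + a * sph_dot v [tuple of behead y] :: [tuple of behead y]].

Definition shear_tail (v : n.-tuple R) (y : pt) : pt :=
  [tuple of thead y :: tuple_axpy (thead y) v [tuple of behead y]].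

(** The symmetry about the axis through [P]; it cancels the components orthogonal to [P]. *)
Definition reflect_tail (y : pt) : pt :=
  [tuple of thead y :: tuple_opp [tuple of behead y]].

Lemma behead_cons_tuple (t : R) (x : n.-tuple R) :
  [tuple of behead [tuple of t :: x]] = x.
Proof. exact: val_inj. Qed.

Lemma measurable_thead : measurable_fun setT (@thead n R).
Proof. exact: measurable_tnth. Qed.

Lemma measurable_shear_head a v : measurable_fun setT (shear_head a v).
Proof.
apply: measurable_cons; last exact: measurable_behead.
apply: measurable_funD; first exact: measurable_thead.
apply: measurable_funM => //; apply: measurable_sph_dot => //.
exact: measurable_behead.
Qed.

Lemma measurable_shear_tail v : measurable_fun setT (shear_tail v).
Proof.
apply: measurable_cons; first exact: measurable_thead.
apply: measurable_tuple_axpy; first exact: measurable_thead.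
exact: measurable_behead.
Qed.

Lemma measurable_reflect_tail : measurable_fun setT reflect_tail.
Proof.
apply: measurable_cons; first exact: measurable_thead.
exact: (measurableT_comp (@measurable_tuple_opp R n) (@measurable_behead _ R n)).
Qed.

Definition iint_preserving (T : pt -> pt) := measurable_fun setT T /\
  forall h : pt -> \bar R, measurable_fun setT h -> (forall x, 0 <= h x)%E ->
  sph_iint (h \o T) = sph_iint h.

Lemma iint_preserving_comp T U :
  iint_preserving T -> iint_preserving U -> iint_preserving (T \o U).
Proof.
move=> [mT iT] [mU iU]; split=> [|h mh h0]; first exact: (measurableT_comp mT mU).
have mhT : measurable_fun setT (h \o T) by exact: (measurableT_comp mh mT).
by rewrite compA iU// => [|x]; [exact: iT | exact: h0].
Qed.

Lemma measurable_comp_cons (h : pt -> \bar R) : measurable_fun setT h ->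
  measurable_fun setT (fun z : R * n.-tuple R => h [tuple of z.1 :: z.2]).
Proof. by move=> mh; apply: (measurableT_comp mh); exact: measurable_cons. Qed.

Lemma measurable_comp_cons_r (h : pt -> \bar R) t : measurable_fun setT h ->
  measurable_fun setT (fun x : n.-tuple R => h [tuple of t :: x]).
Proof. by move=> mh; apply: (measurableT_comp mh); exact: measurable_cons. Qed.

Lemma measurable_comp_cons_l (h : pt -> \bar R) (x : n.-tuple R) : measurable_fun setT h ->
  measurable_fun setT (fun t : R => h [tuple of t :: x]).
Proof. by move=> mh; apply: (measurableT_comp mh); exact: measurable_cons. Qed.

(** Coordinate 0 is translated by an amount depending on the tail. Since its integral is the
    outermost one, it is first moved inside by Tonelli ([E]), after which the tail is fixed. *)
Lemma iint_preserving_shear_head a v : iint_preserving (shear_head a v).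
Proof.
split=> [|h mh h0]; first exact: measurable_shear_head.
have mhs : measurable_fun setT (h \o shear_head a v).
  by apply: measurableT_comp => //; exact: measurable_shear_head.
have E (k : pt -> \bar R) : measurable_fun setT k -> (forall x, 0 <= k x)%E -> sph_iint k =
    sph_iint (fun x => \int[@lebesgue_measure R]_t k [tuple of t :: x])%E.
  move=> mk k0.
  have := integral_sph_iint (@lebesgue_measure R) (measurable_comp_cons mk).
  by rewrite /= => ->.
rewrite (E _ mhs) ?(E _ mh h0) => [|x]; last exact: h0.
apply: eq_sph_iint => x; rewrite /= /shear_head.
under eq_integral do rewrite behead_cons_tuple theadE.
by apply: (ge0_integralT_shift _ (measurable_comp_cons_l x mh)).
Qed.

(** Here the order of integration already fits: for fixed [t] the tail is translated by [t] times
    [v]. *)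
Lemma iint_preserving_shear_tail v : iint_preserving (shear_tail v).
Proof.
split=> [|h mh h0]; first exact: measurable_shear_tail.
rewrite /=; apply: eq_integral => t _; rewrite /shear_tail.
under eq_sph_iint do rewrite behead_cons_tuple theadE.
by apply: (sph_iint_shift _ _ (measurable_comp_cons_r t mh)).
Qed.

Lemma iint_preserving_reflect_tail : iint_preserving reflect_tail.
Proof.
split=> [|h mh h0]; first exact: measurable_reflect_tail.
rewrite /=; apply: eq_integral => t _; rewrite /reflect_tail.
under eq_sph_iint do rewrite behead_cons_tuple theadE.
by apply: (sph_iint_opp (measurable_comp_cons_r t mh)).
Qed.

(* The isometry moving P to x' = (c, v) inside their common plane, as a product of three shears;
   the factorization degenerates at x' = -P, where the antipodal map does the same job. *)
Definition sph_rot (x' : pt) : pt -> pt :=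
  if thead x' == -1 then @tuple_opp R n.+1 else
  let v := [tuple of behead x'] in
  let s := shear_head (- (1 + thead x')^-1) v in s \o (shear_tail v \o s).

Lemma iint_preserving_sph_rot x' : iint_preserving (sph_rot x').
Proof.
rewrite /sph_rot; case: ifP => _.
  split; first exact: measurable_tuple_opp.
  by move=> h mh h0; exact: sph_iint_opp.
have S := iint_preserving_shear_head.
apply: iint_preserving_comp; first exact: S.
by apply: iint_preserving_comp => //; exact: iint_preserving_shear_tail.
Qed.

Lemma thead_scale k (y : pt) : thead (tuple_scale k y) = thead y * k.
Proof. by rewrite /thead tnth_map. Qed.

Lemma behead_scale k (y : pt) :
  [tuple of behead (tuple_scale k y)] = tuple_scale k [tuple of behead y].
Proof. by apply: eq_from_tnth => i; rewrite tnth_behead_tuple !tnth_map tnth_behead_tuple. Qed.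

Lemma cons_scale k t (y : n.-tuple R) :
  tuple_scale k [tuple of t :: y] = [tuple of t * k :: tuple_scale k y].
Proof. exact: val_inj. Qed.

Lemma axpy_scale k t (v y : n.-tuple R) :
  tuple_axpy (t * k) v (tuple_scale k y) = tuple_scale k (tuple_axpy t v y).
Proof. by apply: eq_from_tnth => i; rewrite !(tnth_mktuple, tnth_map); ring. Qed.

Lemma shear_head_scale a v k y :
  shear_head a v (tuple_scale k y) = tuple_scale k (shear_head a v y).
Proof.
rewrite /shear_head cons_scale behead_scale sph_dot_scale thead_scale.
by rewrite mulrDl mulrA.
Qed.

Lemma shear_tail_scale v k y :
  shear_tail v (tuple_scale k y) = tuple_scale k (shear_tail v y).
Proof. by rewrite /shear_tail cons_scale behead_scale thead_scale axpy_scale. Qed.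

Lemma reflect_tail_scale k y :
  reflect_tail (tuple_scale k y) = tuple_scale k (reflect_tail y).
Proof.
rewrite /reflect_tail cons_scale behead_scale thead_scale; congr [tuple of _ :: _].
by apply: eq_from_tnth => i; rewrite !tnth_map mulNr.
Qed.

Lemma sph_rot_scale x' k y : sph_rot x' (tuple_scale k y) = tuple_scale k (sph_rot x' y).
Proof.
rewrite /sph_rot; case: ifP => _.
  by apply: eq_from_tnth => i; rewrite !tnth_map mulNr.
by rewrite /= shear_head_scale shear_tail_scale shear_head_scale.
Qed.

(** With [c] and [v] the head and tail of [x'], each claim is a rational identity in [c], [y_0],
    [<v, y>] and [<y, y>], once [<v, v>] is replaced by [1 - c^2]. The second claim expresses that
    [P] goes to [x'], and the third that the map is an isometry. *)
Lemma sph_rotE x' y : sph_dot x' x' = 1 -> 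
  [/\ thead (sph_rot x' y) = thead x' * thead y - sph_dot [tuple of behead x'] [tuple of behead y],
  sph_dot x' (sph_rot x' y) = thead y & sph_dot (sph_rot x' y) (sph_rot x' y) = sph_dot y y].
Proof.
rewrite sph_dot_thead /sph_rot.
set c := thead x'; set v := [tuple of behead x'] => cv.
have vv : sph_dot v v = 1 - c ^+ 2 by rewrite -cv; ring.
case: ifPn => [/eqP c1|c1].
  (* At [c = -1] the tail of [x'] has norm zero, so all its dot products vanish. *)
  have v0 : sph_dot v v = 0 by rewrite vv c1; ring.
  split.
  - by rewrite (sph_dot_eq0 _ v0) c1 /thead tnth_map; ring.
  - rewrite sph_dot_opp sph_dot_thead -/c -/v (sph_dot_eq0 _ v0) c1; ring.
  - by rewrite sph_dot_opp sph_dotC sph_dot_opp opprK.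
have {}c1 : 1 + c != 0 by rewrite addrC -[1]opprK subr_eq0.
rewrite /= /shear_head /shear_tail.
rewrite !(sph_dot_thead _ [tuple of _ :: _]) !(sph_dot_thead y).
rewrite !(behead_cons_tuple, theadE) -/c -/v.
set x := [tuple of behead y]; set t := thead y.
rewrite (sph_dotC (tuple_axpy _ _ _) (tuple_axpy _ _ _)) !sph_dot_axpy.
rewrite !(sph_dotC (tuple_axpy _ _ _)) !sph_dot_axpy vv (sph_dotC x v).
by split; field.
Qed.

End rotation.

(** * Invariance of the surface integral under isometries, and the averaging formula *)

Section sphere_invariance.
Context {R : realType}.
Variable d : nat.
Notation pt := (d.+1.-tuple R).
Local Open Scope ereal_scope.

(** A homogeneous map preserving norms commutes with normalization and maps the punctured ball to
    itself, so the cone of [g \o T] is the cone of [g] composed with [T]. *)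
Lemma sphere_int_isometry (T : pt -> pt) (g : pt -> \bar R) :
  iint_preserving T -> (forall k y, T (tuple_scale k y) = tuple_scale k (T y)) ->
  (forall y, sph_dot (T y) (T y) = sph_dot y y) ->
  measurable_fun setT g -> (forall x, sphere x -> 0 <= g x) ->
  sphere_int (g \o T) = sphere_int g.
Proof.
move=> [mT iT] hT nT mg g0; rewrite !sphere_intE; congr (_ * _).
rewrite -(iT (sph_cone g)); last 2 first.
- exact: measurable_sph_cone.
- by move=> x; exact: sph_cone_ge0.
apply: eq_sph_iint => y; rewrite /sph_cone /= /sph_nrm nT; case: ifP => // _.
by rewrite -[sph_normalize y]/(tuple_scale (sph_nrm y)^-1 y) hT /sph_normalize /sph_nrm nT.
Qed.

Lemma sphere_int_sph_rot (x' : pt) g : sphere x' ->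
  measurable_fun setT g -> (forall x, sphere x -> 0 <= g x) ->
  sphere_int (g \o sph_rot x') = sphere_int g.
Proof.
move=> sx' mg g0; apply: sphere_int_isometry => //.
- exact: iint_preserving_sph_rot.
- exact: sph_rot_scale.
- by move=> y; have [] := sph_rotE y sx'.
Qed.

Lemma sphere_sph_rot (x' y : pt) : sphere x' -> sphere y -> sphere (sph_rot x' y).
Proof. by move=> sx' sy; rewrite /sphere; have [_ _ ->] := sph_rotE y sx'. Qed.

Lemma sph_dot_reflect_tail (y : pt) : sph_dot (reflect_tail y) (reflect_tail y) = sph_dot y y.
Proof.
rewrite !(sph_dot_thead (reflect_tail _)) (sph_dot_thead y) behead_cons_tuple theadE.
by rewrite sph_dot_opp sph_dotC sph_dot_opp opprK.
Qed.

Lemma sphere_int_reflect_tail (g : pt -> \bar R) :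
  measurable_fun setT g -> (forall x, sphere x -> 0 <= g x) ->
  sphere_int (g \o @reflect_tail R d) = sphere_int g.
Proof.
move=> mg g0; apply: sphere_int_isometry => //.
- exact: iint_preserving_reflect_tail.
- exact: reflect_tail_scale.
- exact: sph_dot_reflect_tail.
Qed.

(* Funk-Hecke for the linear polynomial [2 - 2 x_0], stated with nonnegative weights so that no
   integrability has to be discussed. *)
Lemma sphere_int_coord0_dot (F : R -> R) (x' : pt) : sphere x' ->
  measurable_fun setT F -> (forall c, 0 <= F c)%R ->
  sphere_int (fun x : pt => ((2 - 2 * sph_coord0 x) * F (sph_dot x' x))%:E) =
  ((1 + sph_coord0 x') / 2)%:E *
    sphere_int (fun x : pt => ((2 - 2 * sph_coord0 x) * F (sph_coord0 x))%:E) +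
  ((1 - sph_coord0 x') / 2)%:E *
    sphere_int (fun x : pt => ((2 + 2 * sph_coord0 x) * F (sph_coord0 x))%:E).
Proof.
move=> sx' mF F0.
have m0 := @measurable_sph_coord0 R d.
have mF0 : measurable_fun setT (fun x : pt => F (sph_coord0 x)) by exact: measurableT_comp.
have sph2 (x : pt) : sphere x -> (0 <= 2 - 2 * sph_coord0 x /\ 0 <= 2 + 2 * sph_coord0 x)%R.
  by move=> /sphere_coord0_itv/andP[? ?]; split; lra.
set A := LHS.
(* The integrand after the substitution [x = sph_rot x' y], which turns [<x', x>] into [y_0]. *)
pose G (y : pt) := ((2 - 2 * sph_coord0 (sph_rot x' y)) * F (sph_coord0 y))%:E.
have mrot : measurable_fun setT (sph_rot x') by have [] := iint_preserving_sph_rot x'.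
have mG : measurable_fun setT G.
  apply/measurable_EFinP; apply: measurable_funM => //.
  apply: measurable_funB => //; apply: measurable_funM => //.
  exact: (measurableT_comp m0).
have G0 y : sphere y -> 0 <= G y.
  move=> sy; rewrite lee_fin mulr_ge0//.
  by have [] := sph2 _ (sphere_sph_rot sx' sy).
have AG : A = sphere_int G.
  rewrite /A -(sphere_int_sph_rot sx').
  - by apply: eq_sphere_int => y sy /=; have [_ -> _] := sph_rotE y sx'.
  - apply/measurable_EFinP; apply: measurable_funM => //.
      by apply: measurable_funB => //; exact: measurable_funM.
    by apply: (measurableT_comp mF); exact: measurable_sph_dot.
  - by move=> x /sph2[? _]; rewrite lee_fin mulr_ge0.
(* Adding the reflected integrand removes the term linear in the tail of [y]. *)
have AA : A + A = sphere_int (fun y => G y + G (reflect_tail y)).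
  rewrite sphere_intD//.
  - by rewrite (sphere_int_reflect_tail mG G0) -AG.
  - by apply: (measurableT_comp mG); exact: measurable_reflect_tail.
  - by move=> x sx; apply: G0; rewrite /sphere sph_dot_reflect_tail.
have A0 : 0 <= A by rewrite AG; exact: sphere_int_ge0.
(* [A] is not known to be finite; its nonnegativity justifies the distributivity. *)
have -> : A = (2^-1)%:E * (A + A).
  rewrite ge0_muleDr// -ge0_muleDl ?lee_fin ?invr_ge0// -EFinD.
  by rewrite (_ : 2^-1 + 2^-1 = 1)%R ?mul1e//; field.
have /andP[c1 c2] := sphere_coord0_itv sx'.
have mV : measurable_fun setT (fun x : pt => ((2 - 2 * sph_coord0 x) * F (sph_coord0 x))%:E).
  apply/measurable_EFinP; apply: measurable_funM => //.
  by apply: measurable_funB => //; exact: measurable_funM.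
have mW : measurable_fun setT (fun x : pt => ((2 + 2 * sph_coord0 x) * F (sph_coord0 x))%:E).
  apply/measurable_EFinP; apply: measurable_funM => //.
  by apply: measurable_funD => //; exact: measurable_funM.
have V0 (x : pt) : sphere x -> 0 <= ((2 - 2 * sph_coord0 x) * F (sph_coord0 x))%:E.
  by move=> /sph2[? _]; rewrite lee_fin mulr_ge0.
have W0 (x : pt) : sphere x -> 0 <= ((2 + 2 * sph_coord0 x) * F (sph_coord0 x))%:E.
  by move=> /sph2[_ ?]; rewrite lee_fin mulr_ge0.
have c1' : 0 <= ((1 + sph_coord0 x') / 2)%:E by rewrite lee_fin; lra.
have c2' : 0 <= ((1 - sph_coord0 x') / 2)%:E by rewrite lee_fin; lra.
rewrite AA -!sphere_intZ//; last 2 first.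
- apply: emeasurable_funD => //; apply: (measurableT_comp mG).
  exact: measurable_reflect_tail.
- move=> x sx; apply: adde_ge0; apply: G0 => //.
  by rewrite /sphere sph_dot_reflect_tail.
rewrite -sphere_intD//.
(* With [c = x'_0], the rotated heights of [y] and its reflection are [c y_0] minus and plus the
   same tail product. The mean weight is [2 - 2 c y_0], which equals [(1 + c)/2 (2 - 2 y_0) + (1 -
   c)/2 (2 + 2 y_0)]. *)
- apply: eq_sphere_int => y sy; rewrite /G.
  rewrite -[sph_coord0 (sph_rot _ _)]/(thead (sph_rot _ _)) -[sph_coord0 (sph_rot _ _)]/(thead (sph_rot _ _)).
  have [-> _ _] := sph_rotE y sx'.
  have [-> _ _] := sph_rotE (reflect_tail y) sx'.
  rewrite behead_cons_tuple sph_dot_opp theadE.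
  rewrite /sph_coord0 -/(thead _) -/(thead _) theadE -EFinD -!EFinM -EFinD; congr EFin.
  by rewrite /thead; field.
- exact: measurable_funeM.
- by move=> x sx; rewrite mule_ge0// V0.
- exact: measurable_funeM.
- by move=> x sx; rewrite mule_ge0// W0.
Qed.

End sphere_invariance.

(** * Area of the unit disc and total mass of the circle *)

Section disc_area.
Context {R : realType}.
Local Open Scope ereal_scope.
Notation mu := (@lebesgue_measure R).

Lemma integral_sqrt_oneBsqr :
  \int[mu]_(x in `[(-1)%R, 1%R]) (2 * Num.sqrt (1 - x ^+ 2))%:E = pi%:E.
Proof.
have pi0 := pi_gt0 R.
have cc : continuous (cos : R -> R) by move=> x; exact: continuous_cos.
have cs : continuous (sin : R -> R) by move=> x; exact: continuous_sin.
have -> : (-1 = sin (- (pi / 2)) :> R)%R by rewrite sinN sin_pihalf.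
rewrite -[X in `[_, X]](@sin_pihalf R).
have D1 : derive1 (sin : R -> R) = cos by apply/funext => x; rewrite derive1E derive_val.
have ab : (- (pi / 2) < pi / 2 :> R)%R by lra.
rewrite integration_by_substitution_increasing; first 1 last.
- exact: ltW.
- by move=> x y xab yab; rewrite ltr_sin.
- by rewrite D1 => x _; exact: cc.
- by rewrite D1; apply/cvg_ex; exists (cos (- (pi / 2))); apply: cvg_at_right_filter; exact: cc.
- by rewrite D1; apply/cvg_ex; exists (cos (pi / 2)); apply: cvg_at_left_filter; exact: cc.
- split; [by move=> x _|apply: cvg_at_right_filter; exact: cs|apply: cvg_at_left_filter; exact: cs].
- apply: continuous_subspaceT => x; apply: cvgM; first exact: cvg_cst.
  apply: continuous_comp; last exact: sqrt_continuous.
  by apply: cvgB; [exact: cvg_cst|exact: exprn_continuous].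
pose f (t : R) := (2 * cos t ^+ 2)%R.
(* After the substitution [x = sin t] the integrand is [2 cos^2 t], of which [F] is a primitive. *)
pose F (t : R) := (t + sin t * cos t)%R.
have dF (t : R) : is_derive t 1%R F (f t).
  rewrite /F; apply: is_derive_eq; rewrite /f /GRing.scale/=.
  by have := cos2Dsin2 t; lra.
transitivity (\int[mu]_(t in `[(- (pi / 2))%R, (pi / 2)%R]) (f t)%:E).
  apply: eq_integral => t; rewrite inE/= in_itv/= => tab.
  rewrite D1 /f; congr EFin => /=.
  rewrite fctE/=; by rewrite -cos2sin2 sqrtr_sqr ger0_norm ?cos_ge0_pihalf// expr2 mulrA.
have cF : continuous F.
  by move=> t; apply: differentiable_continuous; apply/derivable1_diffP.
rewrite (continuous_FTC2 (F := F))//.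
- rewrite /F cosN sinN cos_pihalf !mulr0 !addr0 -EFinB; congr EFin; lra.
- apply: continuous_subspaceT => t; apply: cvgM; first exact: cvg_cst.
  by apply: (continuous_comp (g := fun x : R => (x ^+ 2)%R)); [exact: cc|exact: exprn_continuous].
- split; [by move=> t _|apply: cvg_at_right_filter; exact: cF|apply: cvg_at_left_filter; exact: cF].
- by move=> t _; rewrite derive1E derive_val.
Qed.

Lemma disc_slice (s : R) :
  \int[mu]_t (if (s ^+ 2 + t ^+ 2 <= 1)%R then 1 else 0) = (2 * Num.sqrt (1 - s ^+ 2))%:E.
Proof.
set q := Num.sqrt _; have q0 : (0 <= q)%R by exact: sqrtr_ge0.
transitivity (mu [set t : R | (s ^+ 2 + t ^+ 2 <= 1)%R]).
  rewrite -[X in mu X]setIT -integral_indic//.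
    apply: eq_integral => t _; rewrite indicE.
    by case: ifPn => h; [rewrite mem_set|rewrite memNset//; exact/negP].
  rewrite -[X in measurable X]setTI; apply: measurable_fun_ler => //.
  by apply: measurable_funD => //; exact: exprn_measurable.
have [s1|s1] := leP (s ^+ 2)%R 1%R; last first.
  (* For [s^2 > 1] the slice is empty, and the right side is zero because [Num.sqrt] vanishes on
     negative numbers. *)
  rewrite /q ler0_sqrtr; last by lra.
  rewrite (_ : mkset _ = set0) ?measure0 ?mulr0//.
  by apply/seteqP; split => t //= h; have := sqr_ge0 t; lra.
rewrite (_ : mkset _ = `[(- q)%R, q]%classic).
  rewrite lebesgue_measure_itv/= lte_fin; case: ifPn => [_|].
    by rewrite -EFinB; congr EFin; ring.
  by rewrite -leNgt => h; congr EFin; lra.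
have qq : (q ^+ 2 = 1 - s ^+ 2)%R by rewrite sqr_sqrtr//; lra.
apply/seteqP; split=> t /=; rewrite in_itv/=.
  move=> h; rewrite -ler_norml -(@ler_pXn2r _ 2)// ?nnegrE// real_normK ?num_real//.
  by rewrite qq; lra.
rewrite -ler_norml -(@ler_pXn2r _ 2)// ?nnegrE// real_normK ?num_real// qq; lra.
Qed.

(** The cone of the constant 1 is the indicator of the punctured unit disc, of area [pi]; the factor
    2 is the [d.+1] of the cone formula. *)
Lemma sphere_int_circle1 : sphere_int (fun=> 1 : \bar R) (d := 1) = (2 * pi)%:E.
Proof.
rewrite sphere_intE EFinM; congr (_ * _) => /=.
transitivity (\int[mu]_s (2 * Num.sqrt (1 - s ^+ 2))%:E); last first.
  rewrite -integral_sqrt_oneBsqr [RHS]integral_mkcond; apply: eq_integral => s _.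
  rewrite patchE; case: ifPn => // sN; congr EFin.
  rewrite ler0_sqrtr ?mulr0//.
  move: sN; rewrite mem_setE in_itv/= -ler_norml -ltNge => h.
  have : (1 < `|s| ^+ 2)%R by rewrite expr_gt1.
  by rewrite real_normK ?num_real//; lra.
apply: eq_integral => s _; rewrite -disc_slice.
have nE t (y : 0.-tuple R) : sph_nrm [tuple of s :: [tuple of t :: y]] = Num.sqrt (s ^+ 2 + t ^+ 2).
  by rewrite /sph_nrm !sph_dot_thead /sph_dot big_ord0 /= !theadE addr0 -!expr2.
(* The cone omits the origin and the disc contains it; removing the null set [t = 0] from both
   slices avoids the discrepancy. *)
rewrite -(@integral_setD1 _ _ 0%R setT)//; last 2 first.
- by apply: measurableD.
- have mc : measurable_fun setT (@sph_cone R 1 (fun=> 1)) by exact: measurable_sph_cone.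
  apply: measurable_funTS; apply: (measurableT_comp mc
    (g := fun t => [tuple of s :: [tuple of t :: [tuple]]])).
  by apply: measurable_cons => //; exact: measurable_cons.
rewrite -[RHS](@integral_setD1 _ _ 0%R setT)//; last 2 first.
- by apply: measurableD.
- apply/measurable_funTS/measurable_fun_ifT => //; apply: measurable_fun_ler => //.
  by apply: measurable_funD => //; exact: exprn_measurable.
apply: eq_integral => t; rewrite inE/= => -[_ /eqP t0].
rewrite /sph_cone nE.
have st : (0 < s ^+ 2 + t ^+ 2)%R by rewrite ltr_wpDl ?sqr_ge0// exprn_even_gt0.
by rewrite sqrtr_gt0 st -{1}[1%R]sqrtr1 ler_sqrt.
Qed.

End disc_area.

(** * Integrals of periodic functions over one period *)

Section periodic_integral.
Context {R : realType}.
Local Open Scope ereal_scope.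
Notation mu := (@lebesgue_measure R).

Lemma ge0_integral_itv_shift (a b s : R) (h : R -> \bar R) :
  measurable_fun setT h -> (forall t, 0 <= h t) ->
  \int[mu]_(t in `[a, b[) h (t + s)%R = \int[mu]_(t in `[(a + s)%R, (b + s)%R[) h t.
Proof.
move=> mh h0; rewrite integral_mkcond [RHS]integral_mkcond.
rewrite -(ge0_integralT_shift s (f := h \_ `[(a + s)%R, (b + s)%R[)); last 2 first.
- by apply/(measurable_restrictT _ _).1 => //; exact: measurable_funTS.
- by move=> t; exact: erestrict_ge0.
by apply: eq_integral => t _; rewrite !patchE !mem_setE !in_itv/= lerD2r ltrD2r.
Qed.

Lemma ge0_integral_itv_co_split (a b c : R) (h : R -> \bar R) :
  measurable_fun setT h -> (forall t, 0 <= h t) -> (a <= b <= c)%R ->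
  \int[mu]_(t in `[a, c[) h t =
  \int[mu]_(t in `[a, b[) h t + \int[mu]_(t in `[b, c[) h t.
Proof.
move=> mh h0 /andP[ab bc]; rewrite -ge0_integral_setU//=.
- congr (integral _ _ _); apply/seteqP; split=> t /=; rewrite !in_itv/=.
    by move=> /andP[at_ tc]; case: (ltP t b) => tb; [left|right]; apply/andP.
  by case=> /andP[? ?]; apply/andP; split; lra.
- exact: measurable_funTS.
- apply/disj_setPRL => t /=; rewrite !in_itv/= => /andP[bt _]; apply/negP.
  by rewrite negb_and -!leNgt bt orbT.
Qed.

(** The shifted window is split at [pi] and the original one at [- pi + s]. They share [[- pi + s,
    pi[], and the remaining pieces differ by a translation by [2 pi]. *)
Lemma integral_periodic_shift (h : R -> \bar R) (s : R) :
  measurable_fun setT h -> (forall t, 0 <= h t) -> (forall t, h (t + pi *+ 2)%R = h t) ->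
  (0 <= s <= pi *+ 2)%R ->
  \int[mu]_(t in `[(- pi)%R, pi[) h (t + s)%R = \int[mu]_(t in `[(- pi)%R, pi[) h t.
Proof.
move=> mh h0 hp /andP[s0 s2]; have pi0 := pi_gt0 R.
rewrite ge0_integral_itv_shift//.
rewrite (@ge0_integral_itv_co_split _ pi)//; last by apply/andP; split; lra.
rewrite [RHS](@ge0_integral_itv_co_split _ (- pi + s)%R)//; last by apply/andP; split; lra.
rewrite addeC; congr (_ + _).
under [RHS]eq_integral do rewrite -hp.
rewrite ge0_integral_itv_shift//; congr (integral _ _ _).
by apply/seteqP; split=> t /=; rewrite !in_itv/= => /andP[? ?]; apply/andP; split; lra.
Qed.

End periodic_integral.

(** * The circle: angles, rotations, and angular measure as surface measure *)

Section circle.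
Context {R : realType}.
Local Open Scope ereal_scope.
Notation mu := (@lebesgue_measure R).

Lemma thead_sph_pt d (t : R) : thead (sph_pt d t) = cos t.
Proof. by rewrite /thead tnth_mktuple. Qed.

Lemma tnth1_sph_pt (t : R) (i : 'I_1) : tnth (sph_pt 1 t) (lift ord0 i) = sin t.
Proof. by rewrite tnth_mktuple /= ord1. Qed.

Definition sph_pt1E := (@thead_sph_pt 1, tnth1_sph_pt).

Lemma eq_pair_tuple (x y : 2.-tuple R) : thead x = thead y ->
  tnth x (lift ord0 ord0) = tnth y (lift ord0 ord0) -> x = y.
Proof.
move=> x0 x1; apply: eq_from_tnth => i.
by case: (unliftP ord0 i) => [j|] ->; rewrite ?ord1.
Qed.

Lemma sph_dot1E (x y : 2.-tuple R) : sph_dot x y =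
  (thead x * thead y + tnth x (lift ord0 ord0) * tnth y (lift ord0 ord0))%R.
Proof. by rewrite sph_dot_thead /sph_dot big_ord1 !tnth_behead_tuple. Qed.

Lemma sphere_sph_pt1 (t : R) : sphere (sph_pt 1 t).
Proof. by rewrite /sphere sph_dot1E !sph_pt1E -!expr2 cos2Dsin2. Qed.

(** The first coordinate fixes the angle up to sign, and the sign of the second coordinate decides
    between the two. *)
Lemma sphere1P (y : 2.-tuple R) : sphere y ->
  y = sph_pt 1 (acos (thead y)) \/ y = sph_pt 1 (- acos (thead y)).
Proof.
move=> sy; have y1 := sphere_coord0_itv sy.
have : (tnth y (lift ord0 ord0) ^+ 2 = Num.sqrt (1 - thead y ^+ 2) ^+ 2)%R.
  rewrite sqr_sqrtr; first by move: sy; rewrite /sphere sph_dot1E; lra.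
  by move: y1; rewrite /sph_coord0 -/(thead y) => /andP[? ?]; nra.
move=> /eqP; rewrite eqf_sqr => /orP[] /eqP y2; [left|right]; apply: eq_pair_tuple;
  rewrite sph_pt1E ?cosN ?sinN ?acosK//.
- by rewrite y2 -sin_acos.
- by rewrite y2 -sin_acos.
Qed.

(** The rotation matrix of angle [t]; in this explicit form joint measurability in [t] and [x] and
    the addition of angles are immediate, while [circle_rotE] transfers the invariance proved for
    [sph_rot]. *)
Definition circle_rot (t : R) (x : 2.-tuple R) : 2.-tuple R :=
  [tuple of (cos t * thead x - sin t * tnth x (lift ord0 ord0))%R ::
   [tuple of (sin t * thead x + cos t * tnth x (lift ord0 ord0))%R :: [tuple]]].

Lemma circle_rotE t x : circle_rot t x = sph_rot (sph_pt 1 t) x.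
Proof.
apply: eq_pair_tuple.
  have [-> _ _] := sph_rotE x (sphere_sph_pt1 t).
  by rewrite theadE sph_pt1E /sph_dot big_ord1 !tnth_behead_tuple sph_pt1E.
rewrite tnthS tnth0 /sph_rot sph_pt1E; have cs := cos2Dsin2 t.
case: ifPn => [/eqP c1|c1].
  have /eqP : (sin t ^+ 2 = 0)%R by move: cs; rewrite c1; lra.
  by rewrite sqrf_eq0 => /eqP ->; rewrite tnth_map c1; ring.
have {}c1 : (1 + cos t != 0)%R by rewrite addrC -[1%R]opprK subr_eq0.
rewrite /= /shear_head /shear_tail tnthS !behead_cons_tuple !theadE tnth_mktuple.
rewrite /sph_dot !big_ord1 !tnth_behead_tuple !sph_pt1E.
have {}cs : (sin t ^+ 2 = (1 - cos t) * (1 + cos t))%R by move: cs; lra.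
(* [sin^2 t] is isolated so that its factor [1 + cos t] cancels the inverse coming from the
   shears. *)
transitivity (tnth x (lift ord0 ord0) + thead x * sin t
  - (sin t ^+ 2) * (1 + cos t)^-1 * tnth x (lift ord0 ord0))%R; last by ring.
by rewrite cs mulfK//; ring.
Qed.

Lemma circle_rot_sph_pt t s : circle_rot t (sph_pt 1 s) = sph_pt 1 (t + s).
Proof.
apply: eq_pair_tuple; rewrite ?tnthS ?tnth0 ?theadE !sph_pt1E ?cosD ?sinD//.
Qed.

Lemma measurable_circle_rot :
  measurable_fun setT (fun z : R * 2.-tuple R => circle_rot z.1 z.2).
Proof.
have mc : measurable_fun setT (fun z : R * 2.-tuple R => cos z.1).
  apply: (measurableT_comp (f := cos : R -> R)) => //.
  by apply: continuous_measurable_fun; exact: continuous_cos.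
have ms : measurable_fun setT (fun z : R * 2.-tuple R => sin z.1).
  apply: (measurableT_comp (f := sin : R -> R)) => //.
  by apply: continuous_measurable_fun; exact: continuous_sin.
have mt i : measurable_fun setT (fun z : R * 2.-tuple R => tnth z.2 i).
  by apply: (measurableT_comp (f := fun x : 2.-tuple R => tnth x i)) => //; exact: measurable_tnth.
apply: measurable_cons.
  by apply: measurable_funB; apply: measurable_funM => //; exact: mt.
apply: measurable_cons => //.
by apply: measurable_funD; apply: measurable_funM => //; exact: mt.
Qed.

Lemma measurable_sph_pt1 : measurable_fun setT (sph_pt 1 : R -> _).
Proof.
have mp : measurable_fun setT (fun t : R => circle_rot t (sph_pt 1 0)).
  by apply: (measurableT_comp measurable_circle_rot (g := fun t => (t, sph_pt 1 0)));
    exact: measurable_fun_pair.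
by apply: (eq_measurable_fun _ _ mp) => t _; rewrite circle_rot_sph_pt addr0.
Qed.

Lemma sph_ptD2pi d (t : R) : sph_pt d (t + pi *+ 2) = sph_pt d t.
Proof. by apply: eq_from_tnth => i; rewrite !tnth_mktuple cosD2pi sinD2pi. Qed.

(* Integrating [g] over all pairs (rotation by t, point) in both orders compares the two
   rotation-invariant measures on the circle; they agree because both have total mass 2 pi. *)
Lemma integral_circle_angle (g : 2.-tuple R -> \bar R) :
  measurable_fun setT g -> (forall x, sphere x -> 0 <= g x) ->
  \int[mu]_(t in `[(- pi)%R, pi[) g (sph_pt 1 t) = sphere_int g.
Proof.
move=> mg g0; have pi0 := pi_gt0 R.
pose I : set R := `[(- pi)%R, pi[%classic.
(* Extension by zero off [I] lets Tonelli be applied over the whole line. *)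
pose h (z : R * 2.-tuple R) := ((fun z => g (circle_rot z.1 z.2)) \_ (I `*` setT)) z.
have mh : measurable_fun setT h.
  apply/(measurable_restrictT _ _).1; first by apply: measurableX; [exact: measurable_itv|].
  apply: measurable_funTS.
  exact: (measurableT_comp mg measurable_circle_rot).
have hE t x : h (t, x) = ((fun t => g (circle_rot t x)) \_ I) t.
  rewrite /h !patchE; congr (if _ then _ else _).
  by apply/idP/idP; rewrite !inE /= => // -[].
have h0 t x : sphere x -> 0 <= h (t, x).
  move=> sx; rewrite hE; apply: erestrict_ge0 => {}t _; apply: g0.
  by rewrite circle_rotE; apply: sphere_sph_rot => //; exact: sphere_sph_pt1.
(* For each [t] in [I] the inner integral is [sphere_int g] by rotation invariance, and [I] has
   length [2 pi]. *)
have L : \int[mu]_t sphere_int (fun x => h (t, x)) = sphere_int g * (2 * pi)%:E.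
  transitivity (\int[mu]_(t in I) (cst (sphere_int g)) t).
    rewrite [RHS]integral_mkcond; apply: eq_integral => t _; rewrite patchE.
    under eq_sphere_int do rewrite hE patchE.
    case: ifPn => _.
      rewrite -(sphere_int_sph_rot (sphere_sph_pt1 t) mg g0).
      by apply: eq_sphere_int => x _ /=; rewrite circle_rotE.
    exact: sphere_int0.
  have muI : mu I = (2 * pi)%:E.
    rewrite /I lebesgue_measure_itv/= lte_fin ifT; last by lra.
    by rewrite -EFinB; congr EFin; ring.
  by rewrite integral_cst; [congr (_ * _); exact: muI|exact: measurable_itv].
(* At a point [x] of angle [s] the inner integral is the angular integral shifted by [s], hence
   independent of [x] by periodicity. *)
have K : sphere_int (fun x => \int[mu]_t h (t, x)) =
    \int[mu]_(t in I) g (sph_pt 1 t) * (2 * pi)%:E.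
  rewrite -sphere_int_circle1 -sphere_intZ//; last first.
    by apply: integral_ge0 => t _; apply: g0; exact: sphere_sph_pt1.
  apply: eq_sphere_int => x sx; rewrite mule1.
  under eq_integral do rewrite hE.
  rewrite -integral_mkcond.
  have [s s02 ->] : exists2 s, (0 <= s <= pi *+ 2)%R & x = sph_pt 1 s.
    have xi := sphere_coord0_itv sx.
    have a0 := acos_ge0 xi; have api := acos_lepi xi.
    have [->|->] := sphere1P sx.
      by exists (acos (thead x)) => //; apply/andP; split=> //; rewrite -/(sph_coord0 x); lra.
    exists (- acos (thead x) + pi *+ 2)%R; last by rewrite sph_ptD2pi.
    by apply/andP; split; rewrite -/(sph_coord0 x); lra.
  under eq_integral do rewrite circle_rot_sph_pt.
  apply: (integral_periodic_shift (h := fun t => g (sph_pt 1 t))) => //.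
  - by apply: measurableT_comp => //; exact: measurable_sph_pt1.
  - by move=> t; apply: g0; exact: sphere_sph_pt1.
  - by move=> t; rewrite sph_ptD2pi.
have := integral_sphere_int mu mh h0; rewrite L K => /esym.
have c0 : (2 * pi != 0 :> R)%R by apply/eqP; lra.
(* Multiplying by the inverse of [2 pi] cancels it even when the integrals are infinite. *)
by move=> /(congr1 (mule^~ ((2 * pi)^-1)%:E)) /=; rewrite -!muleA -EFinM divff// !mule1.
Qed.

End circle.

(** * Isotropic densities as functions of the first coordinate, uniformly in [d] *)

Section isotropic.
Context {R : realType}.

(** A half great circle from [-P] to [P], parametrized by its height: a measurable choice of one
    point on each parallel. *)
Definition meridian d (c : R) : d.+1.-tuple R :=
  [tuple if i == 0%N :> nat then c else if i == 1%N :> nat then Num.sqrt (1 - c ^+ 2) else 0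
  | i < d.+1].

Lemma coord0_meridian d c : sph_coord0 (@meridian d c) = c.
Proof. by rewrite /sph_coord0 tnth_mktuple. Qed.

Lemma meridianE d c : -1 <= c <= 1 -> meridian d c = sph_pt d (acos c).
Proof.
by move=> c1; apply: eq_from_tnth => i; rewrite !tnth_mktuple acosK// sin_acos.
Qed.

Lemma sphere_meridian d c : (1 <= d)%N -> -1 <= c <= 1 -> sphere (meridian d c).
Proof.
case: d => // d _ /andP[c0 c1]; rewrite /sphere /sph_dot 2!big_ord_recl big1 ?addr0.
  by rewrite !tnth_mktuple/= -!expr2 sqr_sqrtr; [ring|nra].
by move=> i _; rewrite !tnth_mktuple/= mulr0.
Qed.

Lemma measurable_meridian d : measurable_fun setT (@meridian d).
Proof.
apply/measurable_fun_tnthP => i.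
apply: (eq_measurable_fun (fun c : R => if i == 0%N :> nat then c else
    if i == 1%N :> nat then Num.sqrt (1 - c ^+ 2) else 0)).
  by move=> c _; rewrite /= tnth_mktuple.
case: (i == 0%N :> nat) => //; case: (i == 1%N :> nat) => //.
apply: (measurableT_comp (f := Num.sqrt : R -> R) (g := fun c : R => 1 - c ^+ 2)).
  by apply: continuous_measurable_fun; exact: sqrt_continuous.
by apply: measurable_funB => //; exact: exprn_measurable.
Qed.

Lemma measurable_sphere d : measurable [set x : d.+1.-tuple R | sphere x].
Proof.
have md : measurable_fun setT (fun x : d.+1.-tuple R => sph_dot x x).
  exact: measurable_sph_dot.
by have := md measurableT [set 1] (measurable_set1 _); rewrite setTI.
Qed.

Lemma isotropic_meridian d (f : d.+1.-tuple R -> R) (y : d.+1.-tuple R) :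
  (1 <= d)%N -> sph_isotropic f -> sphere y -> f y = f (meridian d (sph_coord0 y)).
Proof.
move=> d1; rewrite /sph_isotropic; have [d1'|_ [F fF] sy] := eqVneq d 1%N.
  subst d => fs sy; rewrite meridianE; last exact: sphere_coord0_itv.
  by have [{1}->|{1}->] := sphere1P sy; rewrite // -fs.
rewrite !fF ?coord0_meridian//; apply: sphere_meridian => //.
exact: sphere_coord0_itv.
Qed.

(** The profile in [sph_isotropic] carries no measurability, and for [d = 1] none is given. Reading
    [f] along the meridian yields a measurable one; extension by zero outside [[-1, 1]] makes it
    nonnegative everywhere. *)
Lemma isotropic_profile d (f : d.+1.-tuple R -> R) : (1 <= d)%N ->
  sph_is_density f -> sph_isotropic f ->
  exists F : R -> R, [/\ measurable_fun setT F, forall c, 0 <= F c &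
    forall y, sphere y -> f y = F (sph_coord0 y)].
Proof.
move=> d1 [mf [f0 _]] fi.
exists ((f \o @meridian d) \_ `[(-1 : R), 1]); split.
- apply/(measurable_restrictT _ _).1; first exact: measurable_itv.
  apply: (measurable_comp (@measurable_sphere d)) => //.
    by move=> _ [c /= c1 <-]; apply: sphere_meridian => //; move: c1; rewrite in_itv.
  by apply: measurable_funTS; exact: measurable_meridian.
- move=> c; rewrite patchE; case: ifPn => // /set_mem /=; rewrite in_itv/= => c1.
  by apply: f0; exact: sphere_meridian.
- move=> y sy; rewrite patchE mem_set/=; first exact: isotropic_meridian.
  by rewrite in_itv/=; exact: sphere_coord0_itv.
Qed.

Local Open Scope ereal_scope.

(** For [d = 1] the angular convolution takes the same form as in higher dimension, because
    [cos (t - s)] is the dot product of the points of angles [t] and [s] and angular measure is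
    surface measure. *)
Lemma sum_densityE d (f1 f2 : d.+1.-tuple R -> R) (f : d.+1.-tuple R -> \bar R) (F1 F2 : R -> R) :
  measurable_fun setT F1 -> measurable_fun setT F2 ->
  (forall c, 0 <= F1 c)%R -> (forall c, 0 <= F2 c)%R ->
  (forall y, sphere y -> f1 y = F1 (sph_coord0 y)) ->
  (forall y, sphere y -> f2 y = F2 (sph_coord0 y)) ->
  sph_is_sum_density f1 f2 f ->
  forall x, sphere x ->
    f x = sphere_int (fun x' => (F1 (sph_coord0 x') * F2 (sph_dot x x'))%:E).
Proof.
move=> mF1 mF2 F10 F20 f1E f2E; rewrite /sph_is_sum_density.
have [d1|_] := eqVneq d 1%N; last by apply.
subst d => fE x sx; have {fE} fE t : f (sph_pt 1 t) =
    sphere_int (fun x' => (F1 (sph_coord0 x') * F2 (sph_dot (sph_pt 1 t) x'))%:E).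
  rewrite fE -integral_circle_angle.
  - apply: eq_integral => s _; rewrite f1E ?f2E; try exact: sphere_sph_pt1.
    by rewrite sph_dot1E /sph_coord0 -!/(thead _) !sph_pt1E cosB.
  - apply/measurable_EFinP; apply: measurable_funM.
      by apply: (measurableT_comp mF1); exact: measurable_sph_coord0.
    by apply: (measurableT_comp mF2); exact: measurable_sph_dot.
  - by move=> y _; rewrite lee_fin mulr_ge0.
by have [->|->] := sphere1P sx.
Qed.

End isotropic.

(** * The moments [V] and [W] of a profile *)

Section sum_variance.
Context {R : realType} (d : nat).
Notation pt := (d.+1.-tuple R).
Local Open Scope ereal_scope.

(** [s = -2] gives the variance [V], and [s = 2] its complement [W]. *)
Definition profile_moment (s : R) (F : R -> R) : \bar R :=
  sphere_int (fun x : pt => ((2 + s * sph_coord0 x) * F (sph_coord0 x))%:E).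

Lemma measurable_profile (s : R) (F : R -> R) : measurable_fun setT F ->
  measurable_fun setT (fun x : pt => ((2 + s * sph_coord0 x) * F (sph_coord0 x))%:E).
Proof.
move=> mF; have m0 := @measurable_sph_coord0 R d.
apply/measurable_EFinP; apply: measurable_funM.
  by apply: measurable_funD => //; exact: measurable_funM.
exact: (measurableT_comp mF m0).
Qed.

Lemma profile_ge0 (s : R) (F : R -> R) (x : pt) : (`|s| <= 2)%R ->
  (forall c, 0 <= F c)%R -> sphere x -> 0 <= ((2 + s * sph_coord0 x) * F (sph_coord0 x))%:E.
Proof.
move=> + F0 /sphere_coord0_itv; rewrite ler_norml => /andP[? ?] /andP[? ?].
by rewrite lee_fin mulr_ge0//; nra.
Qed.

Lemma profile_momentD (F : R -> R) : measurable_fun setT F -> (forall c, 0 <= F c)%R ->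
  sphere_int (fun x : pt => (F (sph_coord0 x))%:E) = 1 ->
  exists v : R, profile_moment (- 2) F = v%:E /\ profile_moment 2 F = (4 - v)%:E.
Proof.
move=> mF F0 F1.
have n2 : (`|-2 : R| <= 2)%R by rewrite normrN ger0_norm.
have n2' : (`|2 : R| <= 2)%R by rewrite ger0_norm.
have : profile_moment (-2) F + profile_moment 2 F = 4%:E.
  rewrite /profile_moment -sphere_intD.
  - rewrite -[RHS]mule1 -F1 -sphere_intZ//.
    + by apply: eq_sphere_int => x _; rewrite -EFinD -EFinM; congr EFin; ring.
    + by apply/measurable_EFinP/(measurableT_comp mF); exact: measurable_sph_coord0.
    + by move=> x _; rewrite lee_fin.
  - exact: measurable_profile.
  - by move=> x sx; exact: profile_ge0.
  - exact: measurable_profile.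
  - by move=> x sx; exact: profile_ge0.
have : 0 <= profile_moment (-2) F by apply: sphere_int_ge0 => x; exact: profile_ge0.
have : 0 <= profile_moment 2 F by apply: sphere_int_ge0 => x; exact: profile_ge0.
(* Two nonnegative extended reals with sum 4 are both finite. *)
case: (profile_moment 2 F) (profile_moment (-2) F) => [w| |] [v| |] //= _ _ [vw].
by exists v; split=> //; congr EFin; rewrite -vw; ring.
Qed.

End sum_variance.

(** * The variance of the sum *)

Unset Implicit Arguments.
Local Close Scope classical_set_scope.

Theorem theorem3p6 (R : realType) (d : nat)
    (f1 f2 : (d.+1).-tuple R -> R) (f : (d.+1).-tuple R -> \bar R) :
  (1 <= d)%N ->
  sph_is_density f1 -> sph_is_density f2 ->
  sph_isotropic f1 -> sph_isotropic f2 ->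
  sph_is_sum_density f1 f2 f ->
  sph_variance f =
    (sph_variance (fun x => (f1 x)%:E) + sph_variance (fun x => (f2 x)%:E)
     - sph_variance (fun x => (f1 x)%:E) * sph_variance (fun x => (f2 x)%:E)
       * (2^-1)%:E)%E.
Proof.
move=> d1 df1 df2 if1 if2 sf.
have [F1 [mF1 F10 f1E]] := isotropic_profile d1 df1 if1.
have [F2 [mF2 F20 f2E]] := isotropic_profile d1 df2 if2.
have fE := sum_densityE mF1 mF2 F10 F20 f1E f2E sf.
have one (g : d.+1.-tuple R -> R) G : sph_is_density g -> (forall y, sphere y -> g y = G (sph_coord0 y)) ->
    sphere_int (fun x : d.+1.-tuple R => (G (sph_coord0 x))%:E) = 1%E.
  by move=> [_ [_ g1]] gG; rewrite -[RHS]g1; apply: eq_sphere_int => x sx; rewrite gG.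
have VE (g : d.+1.-tuple R -> R) G : (forall y, sphere y -> g y = G (sph_coord0 y)) ->
    sph_variance (fun x : d.+1.-tuple R => (g x)%:E) = profile_moment d (- 2) G.
  by move=> gG; rewrite /profile_moment; apply: eq_sphere_int => x /gG ->; rewrite -EFinM mulNr.
rewrite (VE _ _ f1E) (VE _ _ f2E).
have [v1 [V1 W1]] := profile_momentD mF1 F10 (one _ _ df1 f1E).
have [v2 [V2 W2]] := profile_momentD mF2 F20 (one _ _ df2 f2E).
have m0 := @measurable_sph_coord0 R d.
have c2 (x : d.+1.-tuple R) : sphere x -> 0 <= 2 - 2 * sph_coord0 x.
  by move=> /sphere_coord0_itv/andP[? ?]; lra.
pose h (z : d.+1.-tuple R * d.+1.-tuple R) :=
  ((2 - 2 * sph_coord0 z.1) * (F1 (sph_coord0 z.2) * F2 (sph_dot z.1 z.2)))%:E.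
have mK : measurable_fun setT (fun z : d.+1.-tuple R * d.+1.-tuple R =>
    F1 (sph_coord0 z.2) * F2 (sph_dot z.1 z.2)).
  apply: measurable_funM; last by apply: (measurableT_comp mF2); exact: measurable_sph_dot.
  by apply: (measurableT_comp mF1); exact: measurableT_comp.
have mh : measurable_fun setT h.
  apply/measurable_EFinP; apply: measurable_funM => //.
  apply: measurable_funB => //; apply: measurable_funM => //.
  exact: measurableT_comp.
(* The weight [2 - 2 x_0] is constant in [x'] and nonnegative, so it passes under the inner
   integral. *)
have -> : sph_variance f = sphere_int (fun x => sphere_int (fun x' => h (x, x'))).
  apply: eq_sphere_int => x sx; rewrite fE// -sphere_intZ ?lee_fin ?c2//.
  - apply/measurable_EFinP; apply: (measurableT_comp mK (g := fun y => (x, y))).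
    exact: measurable_fun_pair.
  - by move=> y _; rewrite lee_fin mulr_ge0.
rewrite sphere_int_sphere_int//; last first.
  by move=> x y sx sy; rewrite lee_fin mulr_ge0 ?c2// mulr_ge0.
(* After the exchange the outer variable is the intermediate point. Its inner integral
   [(1 + x_0)/2 v2 + (1 - x_0)/2 (4 - v2)] is regrouped by the weights [2 - 2 x_0] and [2 + 2 x_0],
   whose integrals against [F1] are [v1] and [4 - v1]. *)
transitivity (sphere_int (fun x : d.+1.-tuple R =>
    (((4 - v2) / 4)%:E * ((2 + (- 2) * sph_coord0 x) * F1 (sph_coord0 x))%:E +
     (v2 / 4)%:E * ((2 + 2 * sph_coord0 x) * F1 (sph_coord0 x))%:E)%E)).
  apply: eq_sphere_int => x sx.
  under eq_sphere_int => y _.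
    rewrite (_ : h _ = ((F1 (sph_coord0 x))%:E *
      ((2 - 2 * sph_coord0 y) * F2 (sph_dot x y))%:E)%E); last first.
      by rewrite /h /= sph_dotC -EFinM; congr EFin; ring.
    over.
  rewrite sphere_intZ ?lee_fin//; last 2 first.
  - apply/measurable_EFinP; apply: measurable_funM; last first.
      by apply: (measurableT_comp mF2); exact: measurable_sph_dot.
    by apply: measurable_funB => //; exact: measurable_funM.
  - by move=> y sy; rewrite lee_fin mulr_ge0 ?c2.
  rewrite (sphere_int_coord0_dot sx mF2 F20).
  rewrite -/(profile_moment d 2 F2) W2.
  rewrite (_ : sphere_int _ = profile_moment d (- 2) F2); last first.
    by rewrite /profile_moment; apply: eq_sphere_int => y _; rewrite mulNr.
  by rewrite V2 -!EFinM -!EFinD -?EFinM; congr EFin; field.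
have n2 : `|-2 : R| <= 2 by rewrite normrN ger0_norm.
have n2' : `|2 : R| <= 2 by rewrite ger0_norm.
have v20 : 0 <= v2.
  by rewrite -lee_fin -V2; apply: sphere_int_ge0 => x; exact: profile_ge0.
have v24 : 0 <= 4 - v2.
  by rewrite -lee_fin -W2; apply: sphere_int_ge0 => x; exact: profile_ge0.
rewrite sphere_intD; first 1 last.
- by apply: measurable_funeM; exact: measurable_profile.
- by move=> x sx; rewrite mule_ge0 ?lee_fin ?divr_ge0//; exact: profile_ge0.
- by apply: measurable_funeM; exact: measurable_profile.
- by move=> x sx; rewrite mule_ge0 ?lee_fin ?divr_ge0//; exact: profile_ge0.
rewrite !sphere_intZ ?lee_fin ?divr_ge0//; first 1 last.
- exact: measurable_profile.
- by move=> x sx; exact: profile_ge0.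
- exact: measurable_profile.
- by move=> x sx; exact: profile_ge0.
rewrite -/(profile_moment d (- 2) F1) -/(profile_moment d 2 F1) V1 W1 V2.
(* All terms are finite now: [(4 - v2)/4 v1 + v2/4 (4 - v1) = v1 + v2 - v1 v2 / 2]. *)
by rewrite -!EFinM -!EFinD -?EFinB; congr EFin; field.
Qed.
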